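(* Let $G$ be a hyperbolic group. The intersection of finitely many (at least one) quasiconvex products in $G$ is a finite (possibly empty) union of quasiconvex products in $G$.
   Context: Let $\mathcal{A}$ be a finite symmetrized generating set of the hyperbolic group $G$ and $\Gamma(G,\mathcal{A})$ the Cayley graph. A subset $Q\subseteq G$ is quasiconvex if there is $\varepsilon\ge 0$ such that every geodesic in $\Gamma(G,\mathcal{A})$ connecting two elements of $Q$ lies in the closed $\varepsilon$-neighborhood of $Q$ (in a hyperbolic group this does not depend on the choice of $\mathcal{A}$). If $G_1,\dots,G_n$ are quasiconvex subgroups of $G$ and $f_1,\dots,f_n\in G$, $n\in\mathbb{N}$, $n\ge1$, then the set $f_1G_1f_2G_2\cdots f_nG_n=\{f_1g_1f_2g_2\cdots f_ng_n \mid g_i\in G_i,\ i=1,\dots,n\}$ is called a quasiconvex product. *)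

(* Defs.v *)
From mathcomp Require Import all_boot finmap.
From mathcomp Require Import classical_sets.

Set Implicit Arguments.
Unset Strict Implicit.
Unset Printing Implicit Defensive.

Local Open Scope group_scope.
Local Open Scope classical_set_scope.

Definition symmetrized (G : groupType) (A : {fset G}) : Prop :=
  forall a, a \in A -> a^-1 \in A.

Definition generating (G : groupType) (A : {fset G}) : Prop :=
  forall x : G, exists s : seq G,
    (forall a, a \in s -> a \in A) /\ x = \prod_(a <- s) a.

(* Adjacency in the Cayley graph: y = x a for some a in A. *)
Definition cayley (G : groupType) (A : {fset G}) : rel G :=
  [rel x y | x^-1 * y \in A].

(* As in mathcomp.boot.path, an edge path from x is given by the sequence p of
   its vertices after x: the path is x :: p and its length is size p.  Points
   inside edges are ignored: they are within 1/2 of a vertex, which only changes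
   the constants in hyperbolicity and quasiconvexity. *)
Definition cayley_path (G : groupType) (A : {fset G}) (x y : G) (p : seq G) :
    Prop :=
  path (cayley A) x p /\ last x p = y.

(* The distance in the Cayley graph between x and y is at most n. *)
Definition dist_le (G : groupType) (A : {fset G}) (x y : G) (n : nat) : Prop :=
  exists p, cayley_path A x y p /\ size p <= n.

Definition geodesic (G : groupType) (A : {fset G}) (x y : G) (p : seq G) :
    Prop :=
  cayley_path A x y p /\ forall q, cayley_path A x y q -> size p <= size q.

(* The closed eps-neighborhood.  As distances between vertices are natural
   numbers, it suffices to consider natural radii. *)
Definition nbhd (G : groupType) (A : {fset G}) (eps : nat) (Q : set G) :
    set G :=
  [set x | exists2 y, Q y & dist_le A x y eps].

(* Rips' condition: geodesic triangles are uniformly slim.  The sides p, q, r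
   are cyclically oriented, so that rotating x, y, z yields the condition for
   each of the three sides. *)
Definition hyperbolic (G : groupType) (A : {fset G}) : Prop :=
  exists delta : nat, forall (x y z : G) (p q r : seq G),
    geodesic A x y p -> geodesic A y z q -> geodesic A z x r ->
    [set` x :: p] `<=` nbhd A delta ([set` y :: q] `|` [set` z :: r]).

Definition quasiconvex (G : groupType) (A : {fset G}) (Q : set G) : Prop :=
  exists eps : nat, forall (x y : G) (p : seq G),
    Q x -> Q y -> geodesic A x y p -> [set` x :: p] `<=` nbhd A eps Q.

Definition quasiconvex_product (G : groupType) (A : {fset G}) (P : set G) :
    Prop :=
  exists (n : nat) (f : 'I_n -> G) (H : 'I_n -> set G),
    [/\ 0 < n,
        forall i, group_closed (mem (H i)),
        forall i, quasiconvex A (H i) &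
        P = [set x | exists g : 'I_n -> G,
               (forall i, H i (g i)) /\ x = \prod_(i < n) (f i * g i)]].

(* Main.v *)
Require Import Defs.
From mathcomp Require Import all_boot finmap.
From mathcomp Require Import boolp classical_sets.

Set Implicit Arguments.
Unset Strict Implicit.
Unset Printing Implicit Defensive.

Local Open Scope group_scope.
Local Open Scope classical_set_scope.

(** A quasiconvex product is a chain a H1 u1 H2 u2 ... Hn un, where the Hi are
    quasiconvex subgroups; the point is to show that the intersection of two
    chains S = a H u L and T = b K v M, with L and M the remaining chains, is a
    finite union of quasiconvex products. The proof is an induction on the total
    number of subgroups in the two chains ([chain_prod_setI]).

    Let y be in S and T, and follow a geodesic from 1 to y. As triangles are
    slim, each vertex of it is close either to the coset a H or to a point from
    which y is reached along a shorter chain, some final segment of L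
    ([first_coset_or_tail]). The geodesic starts near a, so at some vertex both
    hold ([geodesic_split]). Likewise some vertex is both close to b K and the
    start of a final segment of M. Take the earlier of the two vertices; by
    symmetry, let it be the vertex w that comes from S. Then w is also close to
    b K, because the geodesic joins 1 to a later point close to b K and
    neighborhoods of cosets of quasiconvex subgroups capture such geodesics
    ([between_coset_nbhd]).

    So w = a h r = b k s with r and s in a fixed ball, and the rest w^-1 y of
    the way lies in c L' and in s^-1 K v M, where L' is a final segment of L and
    c is in a fixed ball. There are finitely many labels (r, s, c, L').
    If y0, w0 is one pair with a given label, then all y with this label lie in
    w0 J (c L' `&` s^-1 K v M), where J is the intersection of the conjugates of
    H by r and of K by s; and this whole set is contained in S and in T, since
    whether r c L' is contained in H u L depends on the label only
    ([common_coset_cover]). The subgroup J is quasiconvex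
    ([qc_subgroup_conjI]), and the intersection in parentheses is a finite union
    of quasiconvex products by induction, because L' is shorter than H u L. *)

(** * Words and geodesics in the Cayley graph *)

(* Equality of two words in a group: both sides are freely reduced. *)
Ltac group_eq := by rewrite ?invgM ?invgK ?invg1 ?mulgA;
  do ?[rewrite ?mulgK ?mulgVK ?mulVg ?mulgV ?mul1g ?mulg1].

Section QuasiconvexProducts.
Variables (G : groupType) (A : {fset G}).
Hypotheses (A_sym : symmetrized A) (A_gen : generating A).
Implicit Types (x y z w g c : G) (p q : seq G) (n : nat).

Lemma cayleyM g x y : cayley A (g * x) (g * y) = cayley A x y.
Proof. by rewrite /cayley /= invgM mulgA mulgVK. Qed.

Lemma cayleyC x y : cayley A x y = cayley A y x.
Proof.
rewrite /cayley /=; apply/idP/idP => /A_sym; by rewrite invgM invgK.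
Qed.

Lemma cayley_pathM g x y p :
  cayley_path A x y p -> cayley_path A (g * x) (g * y) (map ( *%g g) p).
Proof.
case=> xp <-; split; last by rewrite last_map.
by rewrite path_map -(eq_path (e := cayley A)) // => u v; rewrite /= cayleyM.
Qed.

Lemma cayley_path_rev x y p :
  cayley_path A x y p -> cayley_path A y x (rev (belast x p)).
Proof.
case=> xp <-; split.
  by rewrite rev_path -(eq_path (e := cayley A)) // => u v; rewrite cayleyC.
by case: p xp => //= a p _; rewrite rev_cons last_rcons.
Qed.

Lemma cayley_path_cat x y z p q :
  cayley_path A x y p -> cayley_path A y z q -> cayley_path A x z (p ++ q).
Proof. by case=> xp <- [yq <-]; split; rewrite ?cat_path ?xp ?last_cat. Qed.

Lemma dist_lexx x n : dist_le A x x n.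
Proof. by exists [::]. Qed.

Lemma dist_leW x y n m : n <= m -> dist_le A x y n -> dist_le A x y m.
Proof. by move=> nm [p [xyp /leq_trans]]; exists p; split=> //; auto. Qed.

Lemma dist_leM g x y n : dist_le A x y n -> dist_le A (g * x) (g * y) n.
Proof.
by case=> p [/(cayley_pathM g) xyp pn]; eexists; split; [exact: xyp|rewrite size_map].
Qed.

Lemma dist_le_sym x y n : dist_le A x y n -> dist_le A y x n.
Proof.
case=> p [/cayley_path_rev xyp pn].
by eexists; split; [exact: xyp|rewrite size_rev size_belast].
Qed.

Lemma dist_le_trans y x z n m :
  dist_le A x y n -> dist_le A y z m -> dist_le A x z (n + m).
Proof.
case=> p [xyp pn] [q [yzq qm]]; exists (p ++ q); split.
  exact: cayley_path_cat xyp yzq.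
by rewrite size_cat leq_add.
Qed.

Definition ball n : set G := [set c | dist_le A 1 c n].

Lemma dist_le_ball x y n : dist_le A x y n -> ball n (x^-1 * y).
Proof. by move=> /(dist_leM x^-1); rewrite mulVg. Qed.

Lemma ball_dist_le x c n : ball n c -> dist_le A x (x * c) n.
Proof. by move=> /(dist_leM x); rewrite mulg1. Qed.

Lemma ball1 n : ball n 1.
Proof. exact: dist_lexx. Qed.

Lemma ballW n m c : n <= m -> ball n c -> ball m c.
Proof. exact: dist_leW. Qed.

Lemma ballV n c : ball n c -> ball n c^-1.
Proof. by move=> /dist_le_sym/dist_le_ball; rewrite mulg1. Qed.

Lemma ballM n m c g : ball n c -> ball m g -> ball (n + m) (c * g).
Proof.
move=> cn gm; apply: dist_le_trans cn _.
exact: ball_dist_le.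
Qed.

Lemma ball_exists c : exists n, ball n c.
Proof.
have [s [sA ->]] := A_gen c; elim: s sA => [|a s IHs] sA.
  by exists 0; rewrite big_nil; apply: ball1.
have [|n sn] := IHs; first by move=> b bs; apply: sA; rewrite inE bs orbT.
exists (1 + n); rewrite big_cons; apply: ballM => //.
exists [:: a]; split=> //; split=> //=.
by rewrite /cayley /= invg1 mul1g andbT; apply: sA; rewrite inE eqxx.
Qed.

(** This is where the generating set has to be finite; the finiteness of every
    set of labels below comes from it. *)
Lemma ball_finite n : exists s : seq G, forall c, ball n c -> c \in s.
Proof.
elim: n => [|n [s sP]].
  by exists [:: 1] => c [p [[_ <-]]]; rewrite leqn0 size_eq0 => /eqP->; rewrite inE.
exists (1 :: [seq a * c | a <- enum_fset A, c <- s]) => c [[|a p] [[/= ap pc] pn]].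
  by rewrite -pc inE eqxx.
move: ap; rewrite /cayley /= invg1 mul1g => /andP[aA ap].
rewrite inE; apply/orP; right; apply/allpairsP; exists (a, a^-1 * c) => /=.
split; [by [] | | by rewrite mulgA mulgV mul1g].
by apply: sP; apply: (@dist_le_ball a); exists p.
Qed.

Lemma geodesic_exists x y : exists p, geodesic A x y p.
Proof.
have [n xyn] := ball_exists (x^-1 * y).
have := ball_dist_le x xyn; rewrite mulgA mulgV mul1g => -[p [xyp _]].
have [m] := ubnP (size p); elim: m => // m IHm in p xyp *; rewrite ltnS => pm.
have [[q [xyq qp]]|pmin] := pselect (exists q, cayley_path A x y q /\ size q < size p).
  exact: IHm q xyq (leq_trans qp pm).
exists p; split=> // q xyq; rewrite leqNgt; apply/negP => qp.
by apply: pmin; exists q.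
Qed.

Lemma geodesicM g x y p :
  geodesic A x y p -> geodesic A (g * x) (g * y) (map ( *%g g) p).
Proof.
case=> xyp pmin; split; first exact: cayley_pathM.
move=> q /(cayley_pathM g^-1); rewrite !mulKg => /pmin.
by rewrite !size_map.
Qed.

Lemma geodesic_rev x y p : geodesic A x y p -> geodesic A y x (rev (belast x p)).
Proof.
case=> xyp pmin; split; first exact: cayley_path_rev.
move=> q /cayley_path_rev/pmin.
by rewrite !size_rev !size_belast.
Qed.

Lemma geodesic_take x y p n :
  geodesic A x y p -> geodesic A x (last x (take n p)) (take n p).
Proof.
case=> -[xp yp] pmin.
move: (xp) (yp); rewrite -{1 2}(cat_take_drop n p) cat_path last_cat.
move=> /andP[xtp tpd] ldy; split=> // q xq.
have /pmin : cayley_path A x y (q ++ drop n p) by apply: cayley_path_cat xq _.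
by rewrite -{1}(cat_take_drop n p) !size_cat leq_add2r.
Qed.

(** Naming the vertices of geodesics without the geodesics makes translation
    and reversal symmetries of a ternary relation. *)
Definition between x y w := exists p, geodesic A x y p /\ w \in x :: p.

Lemma betweenM g x y w : between x y w -> between (g * x) (g * y) (g * w).
Proof.
case=> p [/(geodesicM g) gp wp]; exists (map ( *%g g) p); split=> //.
by rewrite -map_cons map_f.
Qed.

Lemma between_sym x y w : between x y w -> between y x w.
Proof.
case=> p [gp wp]; exists (rev (belast x p)); split; first exact: geodesic_rev.
by case: gp => -[_ <-] _; rewrite inE mem_rev -in_cons -mem_rcons -lastI.
Qed.

Lemma between_take x y p i j : geodesic A x y p -> i <= j ->
  between x (last x (take j p)) (last x (take i p)).
Proof.
move=> /(geodesic_take j) gp ij; exists (take j p); split=> //.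
rewrite -(take_takel p ij); have := mem_last x (take i (take j p)).
by rewrite !inE => /orP[->|/mem_take->] //; rewrite orbT.
Qed.

Lemma between_dist_le x y w n :
  between x y w -> dist_le A x y n -> dist_le A x w n.
Proof.
case=> p [[[xp yp] pmin] wp] [q [/pmin pq qn]].
case/splitPl: wp xp pq {pmin yp} => p1 p2 pw; rewrite cat_path => /andP[xp1 _].
rewrite size_cat => /(leq_trans (leq_addr _ _)) pq; exists p1; split=> //.
exact: leq_trans pq qn.
Qed.

Lemma dist_le_take x y p n : geodesic A x y p ->
  dist_le A (last x (take n p)) (last x (take n.+1 p)) 1.
Proof.
case=> -[xp _] _; have [pn|np] := leqP (size p) n.
  by rewrite !take_oversize ?(leqW pn) //; apply: dist_lexx.
move: xp; rewrite -{1}(cat_take_drop n.+1 p) cat_path (take_nth x np).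
rewrite rcons_path => /andP[/andP[_ e] _]; rewrite last_rcons.
by exists [:: nth x p n]; split=> //; split=> //=; rewrite e.
Qed.

Lemma slim_triangle : hyperbolic A -> exists delta, forall x y w,
  between x y w -> forall z,
  exists2 w', between x z w' \/ between z y w' & dist_le A w' w delta.
Proof.
case=> delta slim; exists delta => x y w [p [gp wp]] z.
have [q gq] := geodesic_exists y z; have [r gr] := geodesic_exists z x.
have [w' w'qr /dist_le_sym ww'] := slim _ _ _ _ _ _ gp gq gr _ wp.
exists w' => //; case: w'qr => ?; [right|left]; apply: between_sym.
  by exists q.
by exists r.
Qed.

(** * Quasiconvex subgroups and neighborhoods of their cosets *)

Hypothesis A_hyp : hyperbolic A.

Record qc_subgroup (H : set G) : Prop := QcSubgroup {
  qc_subgroup_closed : group_closed (mem H);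
  qc_subgroup_quasiconvex : quasiconvex A H }.

Lemma qc_subgroup1 H : qc_subgroup H -> H 1.
Proof. by case=> -[/set_mem]. Qed.

Lemma qc_subgroupV H x : qc_subgroup H -> H x -> H x^-1.
Proof. by case=> /group_closedV HV _ /mem_set/HV/set_mem. Qed.

Lemma qc_subgroupM H x y : qc_subgroup H -> H x -> H y -> H (x * y).
Proof. by case=> /group_closedM HM _ /mem_set Hx /mem_set/(HM _ _ Hx)/set_mem. Qed.

Lemma trivial_qc_subgroup : qc_subgroup [set 1].
Proof.
split.
  split=> [|x y]; first exact/mem_set.
  by move=> /set_mem-> /set_mem->; apply/mem_set; rewrite /= invg1 mulg1.
exists 0 => _ _ p -> -> [_ /(_ [::])]; case: p => [_|a p h]; last first.
  by have : size (a :: p) <= 0 by apply: h.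
move=> w /=; rewrite inE => /eqP->; exists 1 => //; exact: dist_lexx.
Qed.

Definition coset_nbhd (a : G) (H : set G) (n : nat) : set G :=
  [set w | exists h r, [/\ H h, ball n r & w = a * h * r]].

Lemma coset_nbhdW a H n m : n <= m -> coset_nbhd a H n `<=` coset_nbhd a H m.
Proof.
by move=> nm _ [h [r [Hh rn ->]]]; exists h, r; split=> //; apply: ballW nm _.
Qed.

Lemma coset_nbhd_dist_le a H n m w w' :
  coset_nbhd a H n w' -> dist_le A w' w m -> coset_nbhd a H (n + m) w.
Proof.
case=> h [r [Hh rn ->]] /dist_le_ball w'w.
exists h, (r * ((a * h * r)^-1 * w)); split=> //; first exact: ballM.
by rewrite !mulgA mulgV mul1g.
Qed.

(** The geodesic is a side of the quadrilateral 1, a, a h, a h r. Two of the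
    other sides have bounded length, and the side from a to a h is close to a H
    by quasiconvexity. *)
Lemma between_coset_nbhd H a n : qc_subgroup H ->
  exists m, forall x w,
    coset_nbhd a H n x -> between 1 x w -> coset_nbhd a H m w.
Proof.
move=> Hqc; have [delta slim] := slim_triangle A_hyp.
have [k ak] := ball_exists a; have [eps Heps] := qc_subgroup_quasiconvex Hqc.
have H1 := qc_subgroup1 Hqc.
pose m := n + delta + (k + delta + delta) + (eps + delta + delta).
exists m => _ w [h [r [Hh rn ->]]] /slim/(_ (a * h))[w1 bw1 w1w].
case: bw1 => [/slim/(_ a)[w2 bw2 w2w1]|bw1]; last first.
  apply: (@coset_nbhdW _ _ (n + delta)).
    by rewrite /m -!addnA leq_add2l leq_addr.
  apply: coset_nbhd_dist_le w1w; exists h, ((a * h)^-1 * w1).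
  split=> //; last by rewrite mulgA mulgV mul1g.
  apply: dist_le_ball; apply: between_dist_le bw1 _.
  exact: ball_dist_le.
case: bw2 => bw2.
  apply: (@coset_nbhdW _ _ (k + delta + delta)).
    by rewrite /m addnAC leq_addl.
  apply: coset_nbhd_dist_le w1w; apply: coset_nbhd_dist_le w2w1.
  exists 1, (a^-1 * w2); split=> //; last by rewrite mulg1 mulgA mulgV mul1g.
  apply: dist_le_ball; apply: between_dist_le (between_sym bw2) _.
  exact: dist_le_sym.
apply: (@coset_nbhdW _ _ (eps + delta + delta)); first by rewrite leq_addl.
apply: coset_nbhd_dist_le w1w; apply: coset_nbhd_dist_le w2w1.
have := betweenM a^-1 bw2; rewrite mulVg mulgA mulVg mul1g => -[p [gp wp]].
have [h' Hh' /dist_le_sym dh'] := Heps _ _ _ H1 Hh gp _ wp.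
exists h', (h'^-1 * (a^-1 * w2)); split=> //; first exact: dist_le_ball.
by rewrite !mulgA mulgK mulgV mul1g.
Qed.

Lemma uniform_bound (T : eqType) (s : seq T) (Q : T -> nat -> Prop) :
    (forall t n m, n <= m -> Q t n -> Q t m) -> (forall t, exists n, Q t n) ->
  exists n, forall t, t \in s -> Q t n.
Proof.
move=> Qmono Qex; elim: s => [|t s [n ns]]; first by exists 0.
have [m mt] := Qex t; exists (m + n) => u; rewrite inE => /orP[/eqP->|/ns].
  exact: Qmono (leq_addr _ _) mt.
exact: Qmono (leq_addl _ _).
Qed.

Definition conj_set (r : G) (H : set G) : set G := [set x | H (r * x * r^-1)].

(** Conjugates are included in the statement because their intersections are
    what the labels of two chains produce. On a geodesic from 1 to an element j
    of the intersection, a vertex has the form r^-1 h c = s^-1 k d with c and d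
    in a ball. An element g that leads from this vertex into the intersection
    can be chosen to depend on (c, d) only, and one exists because the remaining
    way to j is such an element. Finitely many pairs (c, d) give a bound on the
    length of g. *)
Lemma qc_subgroup_conjI H K r s : qc_subgroup H -> qc_subgroup K ->
  qc_subgroup (conj_set r H `&` conj_set s K).
Proof.
move=> Hqc Kqc.
have conjF (L : set G) (t x y : G) : qc_subgroup L ->
    conj_set t L x -> conj_set t L y ->
    conj_set t L (x^-1 * y) /\ conj_set t L (x * y^-1).
  move=> Lqc Lx Ly; rewrite /conj_set /=.
  have -> : t * (x^-1 * y) * t^-1 = (t * x * t^-1)^-1 * (t * y * t^-1) by group_eq.
  have -> : t * (x * y^-1) * t^-1 = (t * x * t^-1) * (t * y * t^-1)^-1 by group_eq.
  by split; apply: qc_subgroupM => //; apply: qc_subgroupV.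
split.
  split.
    by apply: mem_set; split; rewrite /conj_set /= mulg1 mulgV; apply: qc_subgroup1.
  move=> x y /set_mem[Hx Kx] /set_mem[Hy Ky]; apply/mem_set.
  by split; apply: (conjF _ _ _ _ _ _ _).2.
have [nr rn] := ball_exists r; have [ns sn] := ball_exists s.
have [m Hm] := between_coset_nbhd r^-1 nr Hqc.
have [k Kk] := between_coset_nbhd s^-1 ns Kqc.
have [bm bmP] := ball_finite m; have [bk bkP] := ball_finite k.
pose closes (c : G * G) g := H (c.1 * g * r^-1) /\ K (c.2 * g * s^-1).
have [eps epsP] : exists eps, forall c : G * G,
    c \in [seq (c1, c2) | c1 <- bm, c2 <- bk] ->
    (exists g, closes c g) -> exists2 g, closes c g & ball eps g.
  apply: uniform_bound => [c n n' nn' Qn /Qn[g cg gn]|c].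
    by exists g => //; apply: ballW gn.
  have [[g cg]|no] := pselect (exists g, closes c g); last by exists 0 => /no.
  by have [n gn] := ball_exists g; exists n; exists g.
exists eps => x y p [Hx Kx] [Hy Ky] gp w wp.
have [Hj _] := conjF _ _ _ _ Hqc Hx Hy; have [Kj _] := conjF _ _ _ _ Kqc Kx Ky.
have := betweenM x^-1 (ex_intro _ p (conj gp wp)); rewrite mulVg => bw.
have [|h [c [Hh cm w_h]]] := Hm _ _ _ bw.
  by exists (r * (x^-1 * y) * r^-1), r; split=> //; group_eq.
have [|h' [d [Kh' dk w_h']]] := Kk _ _ _ bw.
  by exists (s * (x^-1 * y) * s^-1), s; split=> //; group_eq.
have [|g0 [Hg0 Kg0] g0eps] := epsP (c, d) (allpairs_f _ (bmP _ cm) (bkP _ dk)).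
  exists (w^-1 * y); split=> /=.
    have -> : c * (w^-1 * y) * r^-1 = h^-1 * (r * (x^-1 * y) * r^-1).
      have -> : w = x * (r^-1 * h * c) by rewrite -w_h; group_eq.
      group_eq.
    by apply: qc_subgroupM => //; apply: qc_subgroupV.
  have -> : d * (w^-1 * y) * s^-1 = h'^-1 * (s * (x^-1 * y) * s^-1).
    have -> : w = x * (s^-1 * h' * d) by rewrite -w_h'; group_eq.
    group_eq.
  by apply: qc_subgroupM => //; apply: qc_subgroupV.
exists (w * g0); last exact: ball_dist_le.
split; rewrite /conj_set /=.
  have -> : r * (w * g0) * r^-1 = (r * x * r^-1) * (h * (c * g0 * r^-1)).
    have -> : w = x * (r^-1 * h * c) by rewrite -w_h; group_eq.
    group_eq.
  by do !apply: qc_subgroupM => //.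
have -> : s * (w * g0) * s^-1 = (s * x * s^-1) * (h' * (d * g0 * s^-1)).
  have -> : w = x * (s^-1 * h' * d) by rewrite -w_h'; group_eq.
  group_eq.
by do !apply: qc_subgroupM => //.
Qed.

(** * Following a geodesic along a chain of cosets *)

Definition translate (a : G) (X : set G) : set G := [set x | X (a^-1 * x)].

Lemma translate1 X : translate 1 X = X.
Proof. by apply/seteqP; split=> x; rewrite /translate /= invg1 mul1g. Qed.

(** H1 u1 H2 u2 ... Hn un. A chain starts with a subgroup, so that a coset
    representative of an initial part is absorbed by a left translation and the
    rest is again a chain. *)
Fixpoint chain_prod (L : seq (set G * G)) : set G :=
  if L is (H, u) :: L' then
    [set x | exists h y, [/\ H h, chain_prod L' y & x = h * u * y]]
  else [set 1].

Fixpoint qc_chain (L : seq (set G * G)) : Prop :=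
  if L is (H, _) :: L' then qc_subgroup H /\ qc_chain L' else True.

Lemma qc_chain_drop i L : qc_chain L -> qc_chain (drop i L).
Proof. by elim: L i => [|[H u] L IHL] [|i] //= [_ /IHL]. Qed.

Lemma chain_prodMl H u L h x : qc_subgroup H -> H h ->
  chain_prod ((H, u) :: L) x -> chain_prod ((H, u) :: L) (h * x).
Proof.
move=> Hqc Hh [h' [y [Hh' Ly ->]]]; exists (h * h'), y; split=> //.
  exact: qc_subgroupM.
by rewrite !mulgA.
Qed.

(** The vertex w can be continued to y along a final segment of the chain L, up
    to a short correction c, and continuing w along any other element of that
    corrected segment stays in S. As i and c take finitely many values, this
    sorts the vertices w into finitely many types of continuation. *)
Definition tail_from (L : seq (set G * G)) (S : set G) (n : nat) (w y : G) :=
  exists i c, [/\ i <= size L, ball n c,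
    translate c (chain_prod (drop i L)) (w^-1 * y)
    & forall z, translate c (chain_prod (drop i L)) z -> S (w * z)].

Lemma tail_fromW L S n m w y :
  n <= m -> tail_from L S n w y -> tail_from L S m w y.
Proof.
by move=> nm [i [c [iL cn cy cS]]]; exists i, c; split=> //; apply: ballW nm _.
Qed.

Lemma tail_from_dist_le L S n m w w' y :
  tail_from L S n w' y -> dist_le A w' w m -> tail_from L S (m + n) w y.
Proof.
case=> i [c [iL cn cy cS]] /dist_le_sym/dist_le_ball w'w.
exists i, (w^-1 * w' * c); split=> //; first exact: ballM.
  move: cy; rewrite /translate /=; congr chain_prod; group_eq.
move=> z Lz; have -> : w * z = w' * (w'^-1 * w * z) by group_eq.
apply: cS; move: Lz; rewrite /translate /=; congr chain_prod; group_eq.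
Qed.

(** For y = a h u y', the triangle with corners 1, a h u and y is slim. Its side
    from 1 to a h u is close to a H, and its side from a h u to y is a translate
    of a geodesic from 1 to y', to which the hypothesis on L applies. *)
Lemma first_coset_or_tail a H u L n0 : qc_subgroup H ->
    (forall y w, chain_prod L y -> between 1 y w ->
      tail_from L (chain_prod L) n0 w y) ->
  exists n, forall y w,
    translate a (chain_prod ((H, u) :: L)) y -> between 1 y w ->
    coset_nbhd a H n w
    \/ tail_from L (translate a (chain_prod ((H, u) :: L))) n w y.
Proof.
move=> Hqc Ltail; have [delta slim] := slim_triangle A_hyp.
have [k uk] := ball_exists u; have [m Hm] := between_coset_nbhd a k Hqc.
exists (m + delta + (delta + n0)) => y w [h [y' [Hh Ly' def_y]]].
have {def_y} -> : y = a * h * u * y' by rewrite -(mulKg a^-1 y) def_y; group_eq.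
move=> /slim/(_ (a * h * u))[w1 [bw1|bw1] w1w]; [left|right].
  apply: (coset_nbhdW (leq_addr (delta + n0) _)); apply: coset_nbhd_dist_le w1w.
  by apply: Hm bw1; exists h, u.
apply: (tail_fromW (leq_addl (m + delta) _)); apply: tail_from_dist_le w1w.
have := betweenM (a * h * u)^-1 bw1; rewrite mulVg mulKg => /(Ltail _ _ Ly').
case=> i [c [iL cn cy cL]]; exists i, c; split=> //.
  by move: cy; rewrite /translate /=; congr chain_prod; group_eq.
move=> z /cL Lz; exists h, ((a * h * u)^-1 * w1 * z); split=> //.
by group_eq.
Qed.

(** A vertex close to the first coset has the whole chain as its continuation,
    so the dichotomy for a chain gives the hypothesis of the dichotomy for the
    chain with one more subgroup. *)
Lemma tail_exists L : qc_chain L -> exists n, forall y w,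
  chain_prod L y -> between 1 y w -> tail_from L (chain_prod L) n w y.
Proof.
elim: L => [_|[H u] L IHL [Hqc /IHL[n0 Ltail]]].
  exists 0 => _ w -> /between_dist_le/(_ (dist_lexx _ 0)) w1.
  exists 0, w^-1; split=> //; first exact: ballV.
    by rewrite /translate /=; group_eq.
  by move=> z; rewrite /translate /= invgK.
have [n Hn] := first_coset_or_tail 1 u Hqc Ltail.
exists n => y w Ly /Hn; rewrite translate1 => /(_ Ly)[[h [r [Hh rn ->]]]|].
  exists 0, r^-1; split=> //; first exact: ballV.
    rewrite /translate drop0 /mkset.
    have -> : r^-1^-1 * ((1 * h * r)^-1 * y) = h^-1 * y by group_eq.
    by apply: chain_prodMl => //; apply: qc_subgroupV.
  move=> z; rewrite /translate drop0 /mkset invgK mul1g -mulgA.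
  exact: chain_prodMl.
by case=> i [c [iL cn cy cL]]; exists i.+1, c.
Qed.

Lemma switch_point (P Q : nat -> Prop) N :
    P 0 -> (forall t, P t \/ Q t) ->
  P N \/ exists2 t, P t & Q t.+1.
Proof.
move=> P0 PQ; elim: N => [|N [PN|]]; [by left| |by right].
by have [?|?] := PQ N.+1; [left|right; exists N].
Qed.

(** Either the geodesic passes from vertices near a H to vertices with a
    continuation along L, and the last vertex before the passage has both
    properties, or y itself is near a H and has the empty continuation. *)
Lemma geodesic_split a H u L : qc_chain ((H, u) :: L) ->
  exists n, forall y p,
    translate a (chain_prod ((H, u) :: L)) y -> geodesic A 1 y p ->
  exists t, coset_nbhd a H n (last 1 (take t p)) /\
    tail_from L (translate a (chain_prod ((H, u) :: L))) n (last 1 (take t p)) y.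
Proof.
case=> Hqc /tail_exists[n0 Ltail].
have [n Hn] := first_coset_or_tail a u Hqc Ltail.
have [k ak] := ball_exists a.
exists (1 + (n + k)) => y p Sy gp.
have nbhdW w : coset_nbhd a H (n + k) w -> coset_nbhd a H (1 + (n + k)) w.
  exact/coset_nbhdW/leqW.
have yp : last 1 p = y by case: gp => -[].
have [||At|[t At Bt]] := @switch_point
  (fun t => coset_nbhd a H (n + k) (last 1 (take t p)))
  (fun t => tail_from L (translate a (chain_prod ((H, u) :: L))) n
              (last 1 (take t p)) y) (size p).
- rewrite take0; exists 1, a^-1; split; first exact: qc_subgroup1.
    exact/(ballW (leq_addl _ _))/ballV.
  by rewrite /=; group_eq.
- move=> t; have [|/(coset_nbhdW (leq_addr k _))|] := Hn y (last 1 (take t p)) Sy.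
  + exists p; split=> //; rewrite -{2}(cat_take_drop t p) -cat_cons mem_cat.
    by rewrite mem_last.
  + by left.
  + by right.
- exists (size p); split; first exact: nbhdW.
  move: At; rewrite take_size yp => _.
  (* At y the continuation is empty, so all of L is dropped. *)
  exists (size L), 1; split=> //; first exact: ball1.
    by rewrite /translate /= drop_size; group_eq.
  by move=> z; rewrite /translate /= drop_size /= invg1 mul1g => ->; rewrite mulg1.
- exists t; split; first exact: nbhdW.
  apply: (@tail_fromW _ _ (1 + n)); first by rewrite leq_add2l leq_addr.
  exact: tail_from_dist_le Bt (dist_le_sym (dist_le_take t gp)).
Qed.

(** * Finite unions of quasiconvex products *)

Inductive qcp_union : set G -> Prop :=
| qcp_union0 : qcp_union set0
| qcp_union_add P X :
    quasiconvex_product A P -> qcp_union X -> qcp_union (P `|` X).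

Lemma qcp_union1 P : quasiconvex_product A P -> qcp_union P.
Proof. by move=> qP; rewrite -(setU0 P); apply: qcp_union_add qP qcp_union0. Qed.

Lemma qcp_unionU X Y : qcp_union X -> qcp_union Y -> qcp_union (X `|` Y).
Proof.
elim=> [|P {}X qP _ IHX] qY; first by rewrite set0U.
by rewrite -setUA; apply: qcp_union_add => //; apply: IHX.
Qed.

Lemma qcp_singleton a : quasiconvex_product A [set a].
Proof.
exists 1%N, (fun=> a), (fun=> [set 1]); split=> //.
- by move=> _; exact: qc_subgroup_closed trivial_qc_subgroup.
- by move=> _; exact: qc_subgroup_quasiconvex trivial_qc_subgroup.
apply/seteqP; split=> x.
  by move=> ->; exists (fun=> 1); split=> //; rewrite big_ord1 mulg1.
by case=> g [/(_ ord0) g1 ->]; rewrite big_ord1 g1 mulg1.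
Qed.

Definition coset_mul (z : G) (J X : set G) : set G :=
  [set x | exists j y, [/\ J j, X y & x = z * j * y]].

Lemma qcp_coset_mul z J P : qc_subgroup J -> quasiconvex_product A P ->
  quasiconvex_product A (coset_mul z J P).
Proof.
move=> [Jgrp Jqc] [n [f [H [_ Hgrp Hqc ->]]]].
pose cons T (x : T) (F : 'I_n -> T) (i : 'I_n.+1) := oapp F x (unlift ord0 i).
have cons0 T (x : T) F : cons T x F ord0 = x by rewrite /cons unlift_none.
have consS T (x : T) F i : cons T x F (lift ord0 i) = F i by rewrite /cons liftK.
have consP T (x : T) F (Q : T -> Prop) :
    Q x -> (forall i, Q (F i)) -> forall i, Q (cons T x F i).
  by move=> Qx QF i; rewrite /cons; case: (unlift _ _).
exists n.+1, (cons _ z f), (cons _ J H); split=> //.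
- exact: (consP _ _ _ (fun H => group_closed (mem H))).
- exact: consP.
apply/seteqP; split=> x.
  case=> j [_ [Jj [g [Hg ->]] ->]]; exists (cons _ j g); split.
    by move=> i; case: (unliftP ord0 i) => [k|] ->; rewrite ?consS ?cons0.
  by rewrite big_ord_recl !cons0; congr (_ * _); apply: eq_bigr => i _; rewrite !consS.
case=> g [Hg ->]; exists (g ord0), (\prod_(i < n) (f i * g (lift ord0 i))); split.
- by have := Hg ord0; rewrite cons0.
- by exists (g \o lift ord0); split=> // i; have := Hg (lift ord0 i); rewrite consS.
by rewrite big_ord_recl !cons0; congr (_ * _); apply: eq_bigr => i _; rewrite !consS.
Qed.

Lemma qcp_union_coset_mul z J X : qc_subgroup J -> qcp_union X ->
  qcp_union (coset_mul z J X).
Proof.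
move=> Jqc; elim=> [|P {}X qP _ IHX].
  suff -> : coset_mul z J set0 = set0 by exact: qcp_union0.
  by apply/seteqP; split=> x // -[j [y []]].
suff -> : coset_mul z J (P `|` X) = coset_mul z J P `|` coset_mul z J X.
  by apply: qcp_union_add => //; apply: qcp_coset_mul.
apply/seteqP; split=> x.
  by case=> j [y [Jj [Py|Xy] ->]]; [left|right]; exists j, y.
by case=> -[j [y [Jj Xy ->]]]; exists j, y; split=> //; [left|right].
Qed.

Lemma qcp_union_sub1 a X : X `<=` [set a] -> qcp_union X.
Proof.
by move=> /subset_set1[] ->; [exact: qcp_union0|exact/qcp_union1/qcp_singleton].
Qed.

(** To write X as a finite union it suffices to give each of finitely many labels
    a part of X that contains all points with this label; the points of the part
    need not have the label themselves. *)
Lemma qcp_union_cover (T : eqType) (s : seq T) (lab : T -> G -> Prop) (X : set G) :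
    (forall t, exists Y, [/\ qcp_union Y, Y `<=` X & forall y, lab t y -> Y y]) ->
  exists Y, [/\ qcp_union Y, Y `<=` X & forall t y, t \in s -> lab t y -> Y y].
Proof.
move=> labX; elim: s => [|t s [Y [qY YX sY]]].
  by exists set0; split=> //; exact: qcp_union0.
have [Z [qZ ZX tZ]] := labX t; exists (Y `|` Z); split=> [||u y].
- exact: qcp_unionU.
- by move=> x [/YX|/ZX].
by rewrite inE => /orP[/eqP->|us] uy; [right; apply: tZ|left; apply: sY uy].
Qed.

(** The inductive step. The covering part of a label is computed from one point
    with this label; a label without points gets the empty part. *)
Lemma common_coset_cover a H u L b K v M n m :
    qc_subgroup H -> qc_subgroup K ->
    let S := translate a (chain_prod ((H, u) :: L)) in
    let T := translate b (chain_prod ((K, v) :: M)) in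
    (forall i c d, qcp_union (translate c (chain_prod (drop i L))
                   `&` translate d (chain_prod ((K, v) :: M)))) ->
  exists Y, [/\ qcp_union Y, Y `<=` S `&` T
    & forall y w, T y -> coset_nbhd a H n w -> coset_nbhd b K m w ->
        tail_from L S n w y -> Y y].
Proof.
move=> Hqc Kqc S T IH.
have [bn bnP] := ball_finite n; have [bm bmP] := ball_finite m.
pose lab (t : (G * G) * (G * nat)) y := let: ((r, s), (c, i)) := t in
  T y /\ exists w, [/\ exists2 h, H h & w = a * h * r,
    exists2 k, K k & w = b * k * s,
    translate c (chain_prod (drop i L)) (w^-1 * y)
    & forall z, translate c (chain_prod (drop i L)) z -> S (w * z)].
have [|Y [qY YST labY]] := @qcp_union_cover _
  [seq (rs, ci) | rs <- [seq (r, s) | r <- bn, s <- bm],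
                  ci <- [seq (c, i) | c <- bn, i <- iota 0 (size L).+1]]
  lab (S `&` T); last first.
  exists Y; split=> // y w Ty [h [r [Hh rn def_w]]] [k [s [Kk sm def_w']]].
  case=> i [c [iL cn cy cS]]; apply: (labY ((r, s), (c, i))).
    rewrite !allpairs_f ?bnP ?bmP //.
    by rewrite mem_iota.
  by split=> //; exists w; split=> //; [exists h|exists k].
move=> [[r s] [c i]].
have [[y0 [_ [w0 [[h0 Hh0 w0h] [k0 Kk0 w0k] _ w0S]]]]|no] :=
  pselect (exists y, lab ((r, s), (c, i)) y); last first.
  exists set0; split=> // [|y labY]; first exact: qcp_union0.
  by case: no; exists y.
(* As w0 lies in a H r and in b K s, the coset of w0 in the first factor is
   exactly the intersection of these two sets. *)
exists (coset_mul w0 (conj_set r H `&` conj_set s K)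
  (translate c (chain_prod (drop i L))
    `&` translate s^-1 (chain_prod ((K, v) :: M)))); split.
- by apply: qcp_union_coset_mul; [apply: qc_subgroup_conjI|apply: IH].
- move=> _ [j [z [[Hj Kj] [Lz Mz] ->]]]; split.
    rewrite /S /translate /mkset.
    have -> : a^-1 * (w0 * j * z) =
        h0 * (r * j * r^-1) * h0^-1 * (a^-1 * (w0 * z)).
      by rewrite w0h; group_eq.
    apply: chain_prodMl => //; last exact: w0S.
    by apply: qc_subgroupM; [|apply: qc_subgroupM|apply: qc_subgroupV].
  rewrite /T /translate /mkset.
  have -> : b^-1 * (w0 * j * z) = k0 * (s * j * s^-1) * (s^-1^-1 * z).
    by rewrite w0k; group_eq.
  by apply: chain_prodMl => //; apply: qc_subgroupM.
move=> y [Ty [w [[h Hh wh] [k Kk wk] Ly _]]].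
exists (w0^-1 * w), (w^-1 * y); split; last by group_eq.
  split; rewrite /conj_set /=.
    have -> : r * (w0^-1 * w) * r^-1 = h0^-1 * h by rewrite w0h wh; group_eq.
    by apply: qc_subgroupM => //; apply: qc_subgroupV.
  have -> : s * (w0^-1 * w) * s^-1 = k0^-1 * k by rewrite w0k wk; group_eq.
  by apply: qc_subgroupM => //; apply: qc_subgroupV.
split=> //; rewrite /translate /mkset.
have -> : s^-1^-1 * (w^-1 * y) = k^-1 * (b^-1 * y) by rewrite wk; group_eq.
by apply: chain_prodMl => //; apply: qc_subgroupV.
Qed.

(** The two uses of [common_coset_cover] correspond to which of the two chains
    has the earlier splitting vertex on the geodesic. *)
Lemma chain_prod_setI a b L M : qc_chain L -> qc_chain M ->
  qcp_union (translate a (chain_prod L) `&` translate b (chain_prod M)).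
Proof.
have [N] := ubnP (size L + size M); elim: N => // N IHN in a b L M *.
have sub1 c X : translate c (chain_prod [::]) `&` X `<=` [set c].
  by move=> x [x1 _]; rewrite -(mulKg c^-1 x) (x1 : _ = _); group_eq.
case: L => [_ _ _|[H u] L]; first exact: qcp_union_sub1 (sub1 a _).
case: M => [_ _ _|[K v] M]; first by rewrite setIC; exact: qcp_union_sub1 (sub1 b _).
rewrite ltnS => ltN LH MK; have [Hqc Lqc] := LH; have [Kqc Mqc] := MK.
set S := translate a _; set T := translate b _.
have [n nP] := geodesic_split a LH; have [m mP] := geodesic_split b MK.
have [n' n'P] := between_coset_nbhd a n Hqc.
have [m' m'P] := between_coset_nbhd b m Kqc.
have [|Y [qY YST Yn]] := @common_coset_cover a H u L b K v M n m' Hqc Kqc.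
  move=> i c d; apply: IHN => //; last exact: qc_chain_drop.
  apply: leq_trans ltN; rewrite /= addSn ltnS leq_add2r size_drop.
  exact: leq_subr.
have [|Z [qZ ZTS Zm]] := @common_coset_cover b K v M a H u L m n' Kqc Hqc.
  move=> i c d; rewrite setIC; apply: IHN => //; last exact: qc_chain_drop.
  apply: leq_trans ltN; rewrite /= addnS ltnS leq_add2l size_drop.
  exact: leq_subr.
suff -> : S `&` T = Y `|` Z by exact: qcp_unionU.
apply/seteqP; split=> [y [Sy Ty]|y [/YST|/ZTS[]]] //.
have [p gp] := geodesic_exists 1 y.
have [t1 [Ht1 tail1]] := nP _ _ Sy gp; have [t2 [Kt2 tail2]] := mP _ _ Ty gp.
have [t12|/ltnW t21] := leqP t1 t2; [left|right].
  by apply: Yn tail1 => //; apply: m'P Kt2 (between_take gp t12).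
by apply: Zm tail2 => //; apply: n'P Ht1 (between_take gp t21).
Qed.

(** A factor f H is the chain {1} f H 1, with the trivial subgroup in front. *)
Lemma qcp_chain P : quasiconvex_product A P ->
  exists2 L, qc_chain L & P = chain_prod L.
Proof.
case=> n [f [H [_ Hgrp Hqc ->]]].
elim: n f H Hgrp Hqc => [|n IHn] f H Hgrp Hqc.
  exists [::] => //; apply/seteqP; split=> x /=.
    by case=> g [_ ->]; rewrite big_ord0.
  by move=> ->; exists (fun=> 1); split=> [[]|] //; rewrite big_ord0.
have [||L Lqc defL] := IHn (f \o lift ord0) (H \o lift ord0).
- by move=> i; apply: Hgrp.
- by move=> i; apply: Hqc.
exists (([set 1], f ord0) :: (H ord0, 1) :: L).
  by split; [exact: trivial_qc_subgroup|split].
apply/seteqP; split=> x.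
  case=> g [Hg ->]; rewrite big_ord_recl.
  exists 1, (g ord0 * \prod_(i < n) (f (lift ord0 i) * g (lift ord0 i))).
  split=> //; last by group_eq.
  exists (g ord0), (\prod_(i < n) (f (lift ord0 i) * g (lift ord0 i))).
  split=> //; last by group_eq.
  by rewrite -defL; exists (g \o lift ord0); split=> // i; apply: Hg.
case=> _ [_ [-> [h [y [Hh Ly ->]]] ->]].
move: (Ly : chain_prod L y); rewrite -defL => -[g [Hg ->]].
exists (fun i => oapp g h (unlift ord0 i)); split.
  by move=> i; case: (unliftP ord0 i) => [k|] -> //; exact: Hg.
rewrite big_ord_recl unlift_none /=; under [in RHS]eq_bigr do rewrite liftK.
by group_eq.
Qed.

Lemma qcp_unionI X Y : qcp_union X -> qcp_union Y -> qcp_union (X `&` Y).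
Proof.
move=> qX qY; elim: qX => [|P {}X qP _ IHX]; first by rewrite set0I; exact: qcp_union0.
rewrite setIUl; apply: qcp_unionU => //.
elim: qY {IHX} => [|Q {}Y qQ _ IHY]; first by rewrite setI0; exact: qcp_union0.
rewrite setIUr; apply: qcp_unionU => //.
have [L Lqc ->] := qcp_chain qP; have [M Mqc ->] := qcp_chain qQ.
rewrite -(translate1 (chain_prod L)) -(translate1 (chain_prod M)).
exact: chain_prod_setI.
Qed.

Lemma qcp_union_bigcap m (P : 'I_m.+1 -> set G) :
  (forall i, quasiconvex_product A (P i)) -> qcp_union (\bigcap_i P i).
Proof.
elim: m P => [|m IHm] P qP.
  suff -> : \bigcap_i P i = P ord0 by exact: qcp_union1.
  by apply/seteqP; split=> [x /(_ ord0 I)|x Px i _] //; rewrite ord1.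
suff -> : \bigcap_i P i = P ord0 `&` \bigcap_i P (lift ord0 i).
  by apply: qcp_unionI; [exact: qcp_union1|apply: IHm => i].
apply/seteqP; split=> [x Px|x [P0 PS] i _].
  by split=> [|i _]; apply: Px.
by case: (unliftP ord0 i) => [j|] -> //; apply: PS.
Qed.

Lemma qcp_union_indexed X : qcp_union X ->
  exists (k : nat) (U : 'I_k -> set G),
    (forall j, quasiconvex_product A (U j)) /\ X = \bigcup_j U j.
Proof.
elim=> [|P {}X qP _ [k [U [qU ->]]]].
  exists 0, (fun=> set0); split=> [[]|] //.
  by apply/seteqP; split=> x // -[[]].
exists k.+1, (fun i => oapp U P (unlift ord0 i)); split.
  by move=> j; case: (unlift _ _) => /=.
apply/seteqP; split=> x.
  case=> [Px|[j _ Uj]]; first by exists ord0; rewrite ?unlift_none.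
  by exists (lift ord0 j); rewrite ?liftK.
case=> j _; case: (unliftP ord0 j) => [i|] _ /=; last by left.
by right; exists i.
Qed.

End QuasiconvexProducts.

Theorem corollary2 (G : groupType) (A : {fset G})
    (A_sym : symmetrized A) (A_gen : generating A) (A_hyp : hyperbolic A)
    (m : nat) (m_gt0 : 0 < m) (P : 'I_m -> set G)
    (P_qcp : forall i, quasiconvex_product A (P i)) :
  exists (k : nat) (U : 'I_k -> set G),
    (forall j, quasiconvex_product A (U j)) /\
    \bigcap_i P i = \bigcup_j U j.
Proof.
case: m m_gt0 P P_qcp => // m _ P P_qcp.
exact/qcp_union_indexed/qcp_union_bigcap.
Qed.
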